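(* Let $\Omega=\{1,2\}^{\mathbb{N}}$. Let $(p_1,p_2)$ and $(q_1,q_2)$ be probability vectors, let $\mu$ be the independent Bernoulli (product) probability on $\Omega$ associated to $(p_1,p_2)$, and let $\nu$ be the independent Bernoulli (product) probability on $\Omega$ associated to $(q_1,q_2)$. Suppose $p_1\le q_1$. Then $$\bar d(\mu,\nu)=q_1-p_1=\tfrac12\big(|q_1-p_1|+|q_2-p_2|\big).$$
   Context: Points of $\Omega$ are written $x=(x_0,x_1,x_2,\dots)$ and $\sigma:\Omega\to\Omega$ is the shift $\sigma(x_0,x_1,\dots)=(x_1,x_2,\dots)$. For $\sigma$-invariant Borel probabilities $\mu,\nu$ on $\Omega$, a joining of $\mu$ and $\nu$ is a Borel probability on $\Omega\times\Omega$ with first marginal $\mu$ and second marginal $\nu$ which is invariant under $(x,y)\mapsto(\sigma(x),\sigma(y))$; $J(\mu,\nu)$ is the set of joinings. The $\bar d$-distance is $$\bar d(\mu,\nu)=\inf_{\lambda\in J(\mu,\nu)}\int I_{\{x_0\ne y_0\}}\,\lambda(dx,dy)=\inf_{\lambda\in J(\mu,\nu)}\lambda\{(x,y):x_0\neq y_0\}.$$ *)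

(* Defs.v *)
From HB Require Import structures.
From mathcomp Require Import all_boot all_order all_algebra.
From mathcomp Require Import all_classical all_reals all_analysis.
Import Order.TTheory GRing.Theory Num.Theory.
Import numFieldNormedType.Exports.

Set Implicit Arguments.
Unset Strict Implicit.
Unset Printing Implicit Defensive.

Local Open Scope classical_set_scope.
Local Open Scope ring_scope.

(* The alphabet {1, 2} is encoded by bool: false stands for the symbol 1 and
   true for the symbol 2. *)
Notation Omega := cantor_space.

Definition shift (x : Omega) : Omega := fun n => x n.+1.

Notation Borel T := (g_sigma_algebraType (@open T%type)).

(* The Borel sets of Omega * Omega are those of the product topology. *)
Notation Omega2 := (Omega * Omega)%type.

Definition shift2 (z : Omega2) : Omega2 := (shift z.1, shift z.2).

Definition symbol_weight (R : realType) (w1 w2 : R) (a : bool) : R :=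
  if a then w2 else w1.

(* The product measure is characterised by its values on cylinders. *)
Definition is_bernoulli (R : realType) (w1 w2 : R)
    (mu : probability (Borel Omega) R) : Prop :=
  forall (n : nat) (a : nat -> bool),
    mu [set x : Omega | forall i, (i < n)%N -> x i = a i] =
    (\prod_(i < n) symbol_weight w1 w2 (a i))%:E.

Definition joinings (R : realType) (mu nu : probability (Borel Omega) R) :
    set (probability (Borel Omega2) R) :=
  [set lam | [/\ forall A : set (Borel Omega), measurable A ->
                   lam ((fst : Omega2 -> Omega) @^-1` A) = mu A,
                 forall A : set (Borel Omega), measurable A ->
                   lam ((snd : Omega2 -> Omega) @^-1` A) = nu A
               & forall C : set (Borel Omega2), measurable C ->
                   lam (shift2 @^-1` C) = lam C]].

Definition first_symbols_differ : set Omega2 :=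
  [set z | z.1 0%N <> z.2 0%N].

Definition dbar (R : realType) (mu nu : probability (Borel Omega) R) : \bar R :=
  ereal_inf [set (\int[lam]_z (\1_first_symbols_differ z : R)%:E)%E
            | lam in joinings mu nu].

(* Main.v *)
(** Lower bound: under any joining, [y0 = 1] forces [x0 = 1] or [x0 <> y0],
    so [q1 <= p1 + lam (x0 <> y0)].
    Upper bound: the joining that couples the coordinates independently, each
    pair [(x_i, y_i)] being distributed as [(p1 <= U, q1 <= U)] with [U] uniform
    on [0, 1[, where [true] stands for the symbol 2.
    This i.i.d. pair process is the symbolic coding of the piecewise affine
    expanding map of [0, 1[ with full branches on [0, p1[, [p1, q1[ and
    [q1, 1[: the points with a prescribed coding of length [n] form an interval
    whose length is the product of the branch widths. *)

From HB Require Import structures.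
Require Import Defs.
From mathcomp Require Import all_boot all_order all_algebra.
From mathcomp Require Import all_classical all_reals all_analysis.
From mathcomp Require Import measurable_realfun ring lra.
Import Order.TTheory GRing.Theory Num.Theory.
Import numFieldNormedType.Exports.

Local Open Scope classical_set_scope.
Local Open Scope ring_scope.

(** * Cylinders and the Borel sets they generate *)

(** The coordinate map [X] is a parameter so that the same lemmas serve [Omega] and [Omega2], the
    latter seen as a space of sequences of pairs. *)
Definition cylinder {T S : Type} (X : T -> nat -> S) (n : nat) (a : nat -> S) :
    set T :=
  [set x | forall i, (i < n)%N -> X x i = a i].

(* [X x i] is the [i]-th coordinate of the point [x]; this makes the cylinders
   of [X] clopen and a neighbourhood base of every point. *)
Definition cylinder_base {T : topologicalType} {S : Type} (X : T -> nat -> S) :=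
  (forall i s, open [set x | X x i = s]) /\
  (forall x U, nbhs x U -> exists n, cylinder X n (X x) `<=` U).

(** The empty set is added to obtain a family closed under intersection. *)
Definition cylinders {T S : Type} (X : T -> nat -> S) : set (set T) :=
  [set A | A = set0 \/ exists n a, A = cylinder X n a].

Lemma open_coordinates {T : topologicalType} {S : Type} (X : T -> nat -> S)
    (Q : nat -> set S) (n : nat) :
  cylinder_base X -> open [set x | forall i, (i < n)%N -> Q i (X x i)].
Proof.
move=> [oX _]; elim: n => [|n IHn].
  by rewrite (_ : [set x | _] = setT); [exact: openT|apply/seteqP; split].
rewrite (_ : [set x | _] = [set x | forall i, (i < n)%N -> Q i (X x i)] `&`
    \bigcup_(s in Q n) [set x | X x n = s]).
  by apply: openI => //; apply: bigcup_open => s _; exact: oX.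
apply/seteqP; split=> [x Qx|x [Qx [s Qs Xs]] i].
  by split=> [i ltin|]; [apply: Qx; exact: ltnW|exists (X x n) => //; exact: Qx].
rewrite ltnS leq_eqVlt => /predU1P[->|]; last exact: Qx.
by rewrite Xs.
Qed.

(** There are only countably many finite words over a countable alphabet, so each open set is a
    countable union of the cylinders it contains. *)
Lemma borel_cylinders {T : ptopologicalType} {S : countType} (X : T -> nat -> S) :
  cylinder_base X -> @measurable _ (Borel T) = <<s cylinders X >>.
Proof.
move=> bX; apply/seteqP; split; last first.
  apply: sub_sigma_algebra2 => _ [->|[n [a ->]]]; first exact: open0.
  exact: (open_coordinates X (fun i => [set a i])).
apply: smallest_sub => [|O oO]; first exact: smallest_sigma_algebra.
(* [s] runs over the finite words. The default of [nth] is never read: the cylinder only constrains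
   indices below [size s]. *)
pose F (s : seq S) := let a := nth (X point 0%N) s in
  if `[< cylinder X (size s) a `<=` O >] then cylinder X (size s) a
  else set0.
have -> : O = \bigcup_s F s.
  apply/seteqP; split=> [x Ox|x [s _]]; last first.
    by rewrite /F; case: asboolP => // sO; exact: sO.
  have [n nO] := bX.2 _ _ (open_nbhs_nbhs (conj oO Ox)).
  have nE : cylinder X (size (mkseq (X x) n))
      (nth (X point 0%N) (mkseq (X x) n)) = cylinder X n (X x).
    rewrite /cylinder size_mkseq; apply/seteqP.
    by split=> y ya i ltin; rewrite ya ?nth_mkseq.
  exists (mkseq (X x) n) => //; rewrite /F nE.
  by case: asboolP.
have := @countable_bigcupT_measurable _ (g_sigma_algebraType (cylinders X)) _ F.
apply; first exact: countableP.
move=> s; apply: sub_sigma_algebra; rewrite /F; case: asboolP => _; last by left.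
by right; eexists; eexists.
Qed.

Lemma setI_closed_cylinders {T S : Type} (X : T -> nat -> S) :
  setI_closed (cylinders X).
Proof.
move=> A B [->|[n [a ->]]]; first by rewrite set0I; left.
move=> [->|[m [b ->]]]; first by rewrite setI0; left.
have [[x [xa xb]]|/set0P/negP/negPn/eqP ->] :=
  pselect (cylinder X n a `&` cylinder X m b !=set0); last by left.
(* Two cylinders with a common point [x] meet in the cylinder around [x] of the larger length. *)
right; exists (maxn n m), (X x).
apply/seteqP; split=> y.
  by move=> [ya yb] i; rewrite leq_max => /orP[ltin|ltim];
    [rewrite ya// xa|rewrite yb// xb].
by move=> yx; split=> i lti; rewrite yx ?(xa _ lti) ?(xb _ lti)// leq_max lti ?orbT.
Qed.

Lemma eq_probability_cylinder {R : realType} {T : ptopologicalType}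
    {S : countType} (X : T -> nat -> S) (P Q : probability (Borel T) R) :
    cylinder_base X ->
    (forall n a, P (cylinder X n a) = Q (cylinder X n a)) ->
  forall A : set (Borel T), measurable A -> P A = Q A.
Proof.
move=> bX PQ A mA.
have := @measure_unique _ R (Borel T) (cylinders X) (fun=> setT); apply => //.
- exact: borel_cylinders.
- exact: setI_closed_cylinders.
- by move=> _; right; exists 0%N, (fun=> X point 0%N); apply/seteqP; split.
- by apply/seteqP; split=> // x _; exists 0%N.
- by move=> _ [->|[n [a ->]]]; [rewrite !measure0|exact: PQ].
- by move=> _ /=; rewrite probability_setT ltry.
Qed.

Lemma cylinder_base_Omega :
  cylinder_base (fun x : Omega => x : nat -> bool).
Proof.
split=> [i s|x U xU].
  have pi : continuous (fun x : Omega => x i : bool).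
    exact: (@proj_continuous nat (fun=> bool) i).
  exact: (proj1 (continuousP _) pi [set s] (discrete_open _)).
(* The filter generated by the cylinders around [x] converges to [x] coordinatewise, hence it
   contains every neighbourhood of [x]. *)
pose F := filter_from [set: nat] (fun n => cylinder (fun x : Omega => x) n x).
have FF : Filter F.
  apply: filter_from_filter; first by exists 0%N.
  move=> n m _ _; exists (maxn n m) => // y yx.
  by split=> i lti; apply: yx; rewrite leq_max lti ?orbT.
have : (F : set_system Omega) --> x.
  apply/(@pointwise_cvgP nat bool F x FF) => t A /nbhs_singleton Ax.
  by exists t.+1 => // y yx /=; rewrite yx.
by move=> /(_ U xU) [n _ nU]; exists n.
Qed.

Lemma cylinder_base_Omega2 :
  cylinder_base (fun (z : Omega2) i => (z.1 i, z.2 i)).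
Proof.
have [oX bX] := cylinder_base_Omega.
split=> [i [a b]|[x y] U [[A B] /= [xA yB] ABU]].
  rewrite (_ : [set _ | _] = fst @^-1` [set x : Omega | x i = a] `&`
      snd @^-1` [set x : Omega | x i = b]); last first.
    by apply/seteqP; split=> [z /= [-> ->]|z /= [-> ->]].
  by apply: openI; apply: open_comp => // z _; [exact: cvg_fst|exact: cvg_snd].
have [n nA] := bX _ _ xA; have [m mB] := bX _ _ yB.
exists (maxn n m) => -[x' y'] /= xy; apply: ABU; split=> /=.
  by apply: nA => i lti; have := xy i; rewrite leq_max lti => /(_ erefl) [].
by apply: mB => i lti; have := xy i; rewrite leq_max lti orbT => /(_ erefl) [].
Qed.

Lemma measurable_fun_coordinates {d} {D : measurableType d}
    {T : ptopologicalType} {S : countType} (X : T -> nat -> S) (f : D -> Borel T) :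
    cylinder_base X -> (forall i s, measurable [set u | X (f u) i = s]) ->
  measurable_fun setT f.
Proof.
move=> bX mX; apply: (@measurability _ _ D (Borel T) setT f (cylinders X)).
  exact: borel_cylinders.
move=> _ [_ [->|[n [a ->]]] <-]; first by rewrite preimage_set0 setI0.
rewrite setTI; elim: n => [|n IHn].
  by rewrite (_ : _ @^-1` _ = setT)//; apply/seteqP; split.
rewrite (_ : _ @^-1` _ = f @^-1` cylinder X n a `&` [set u | X (f u) n = a n]).
  by apply: measurableI.
apply/seteqP; split=> [u ua|u [ua uan] i].
  by split=> [i ltin|]; apply: ua => //; exact: ltnW.
by rewrite ltnS leq_eqVlt => /predU1P[->//|]; exact: ua.
Qed.

(** * I.i.d. sequences from the coding of an expanding map *)

(* [l s] and [w s] are the left endpoint and the width of the branch of the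
   expanding map [T] coded by [s].
   A branch of width [w s = 0] is empty; the junk value [x / 0 = 0] is then
   never used, since the corresponding interval is empty too. *)
Lemma coding_interval {R : realFieldType} {S : eqType} (l w : S -> R)
    (sym : R -> S) (T : R -> R) :
    (forall s, 0 <= l s) -> (forall s, 0 <= w s) -> (forall s, l s + w s <= 1) ->
    (forall u s, 0 <= u < 1 -> (sym u == s) = (l s <= u < l s + w s)) ->
    (forall u, T u = (u - l (sym u)) / w (sym u)) ->
  forall n (a : nat -> S), exists s t,
    [/\ 0 <= s, s <= t, t <= 1, t - s = \prod_(i < n) w (a i) &
      forall u, 0 <= u < 1 ->
        (forall i, (i < n)%N -> sym (iter i T u) = a i) <-> s <= u < t].
Proof.
move=> l_ge0 w_ge0 lw_le1 symE TE; elim=> [|n IHn] a.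
  by exists 0, 1; rewrite big_ord0 subr0; split.
have [s [t [s_ge0 le_st t_le1 tsE IH]]] := IHn (fun i => a i.+1).
set l0 := l (a 0%N); set w0 := w (a 0%N).
have w0_ge0 : 0 <= w0 := w_ge0 _.
have l0_ge0 : 0 <= l0 := l_ge0 _.
have lw0 : l0 + w0 <= 1 := lw_le1 _.
(* The interval of the word without its first symbol is pulled back through the affine branch coded
   by [a 0]. *)
exists (l0 + w0 * s), (l0 + w0 * t); split; [nra|nra|nra| |].
  by rewrite big_ord_recl/= -tsE -/w0; ring.
move=> u u01.
have -> : (l0 + w0 * s <= u < l0 + w0 * t) =
    (sym u == a 0%N) && (s <= (u - l0) / w0 < t).
  rewrite symE// -/l0 -/w0; move: w0_ge0; rewrite le_eqVlt => /predU1P[<-|w0_gt0].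
    by rewrite !mul0r addr0; case: ltgtP.
  rewrite ler_pdivlMr// ltr_pdivrMr//; apply/idP/idP; last lra.
  by move=> H; apply/andP; split; [nra|lra].
have [u0|nu0] := eqVneq (sym u) (a 0%N); last first.
  by split=> // ua; move: nu0; rewrite (ua 0%N)// eqxx.
have TuE : T u = (u - l0) / w0 by rewrite TE u0.
have /andP[lu uw] : l0 <= u < l0 + w0 by rewrite -symE// u0.
have w0_gt0 : 0 < w0 by lra.
have Tu01 : 0 <= T u < 1.
  by rewrite TuE ler_pdivlMr// ltr_pdivrMr//; lra.
rewrite /= -TuE -IH//; split=> [ua i ltin|ua [|i] ltin//].
  by rewrite -ua// iterSr.
by rewrite iterSr ua.
Qed.

Definition unit_lebesgue (R : realType) :=
  mrestr (@lebesgue_measure R) (measurable_itv `[0 : R, 1[).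

HB.instance Definition _ (R : realType) := Measure.on (unit_lebesgue R).

Lemma unit_lebesgueT (R : realType) : unit_lebesgue R setT = 1%:E.
Proof. by rewrite /unit_lebesgue /mrestr setTI lebesgue_measure_itv/= lte01 sube0. Qed.

HB.instance Definition _ (R : realType) :=
  Measure_isProbability.Build _ _ R (unit_lebesgue R) (unit_lebesgueT R).

(** The event is a disjoint union of cylinders, one per admissible word of length [n];
    distributivity turns the sum of products into a product of sums. *)
Lemma probability_coordinates {R : realType} {T : ptopologicalType}
    {S : finType} (X : T -> nat -> S) (w : S -> R) (P : probability (Borel T) R) :
    cylinder_base X ->
    (forall n a, P (cylinder X n a) = (\prod_(i < n) w (a i))%:E) ->
  forall n (Q : nat -> pred S),
    P [set x | forall i, (i < n)%N -> Q i (X x i)] =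
    (\prod_(i < n) \sum_(s | Q i s) w s)%:E.
Proof.
move=> bX PX n Q; rewrite bigA_distr_big_dep.
(* Extends a word of length [n] to a sequence; the values from index [n] on do not affect the
   cylinder of length [n]. *)
pose ext (f : {ffun 'I_n -> S}) (i : nat) :=
  if insub i is Some j then f j else X point 0%N.
have extE f (i : 'I_n) : ext f i = f i by rewrite /ext valK.
have -> : [set x | forall i, (i < n)%N -> Q i (X x i)] =
    \bigcup_(f in [set f | f \in family (Q \o val : 'I_n -> _)]) cylinder X n (ext f).
  apply/seteqP; split=> [x Qx|x [f /familyP Qf xf] i ltin].
    exists [ffun i : 'I_n => X x i].
      by apply/familyP => i; rewrite ffunE; exact: (Qx i (ltn_ord i)).
    by move=> i ltin; rewrite (extE _ (Ordinal ltin)) ffunE.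
  by rewrite xf// (extE _ (Ordinal ltin)); exact: (Qf (Ordinal ltin)).
rewrite measure_fin_bigcup//; last 2 first.
- move=> f g _ _ [x [xf xg]]; apply/ffunP => i.
  by rewrite -(extE f) -(extE g) -xf ?xg.
- move=> f _; apply: sub_sigma_algebra.
  exact: (open_coordinates X (fun i => [set ext f i])).
pose F : {pred {ffun 'I_n -> S}} := family (Q \o val : 'I_n -> pred S).
have memE f : (f \in enum F) = (f \in F) := mem_enum F f.
rewrite (fsbigE (enum F))//=; last 3 first.
- exact: enum_uniq.
- by move=> f /=; rewrite memE.
- by move=> f /= Ff; rewrite memE => /negP.
rewrite -sumEFin big_enum_cond/=; apply: eq_big => [f|f _].
  by rewrite andb_idr// => ?; rewrite inE.
by rewrite PX; congr (_%:E); apply: eq_bigr => i _; rewrite extE.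
Qed.

HB.instance Definition _ (T U : ptopologicalType) := Pointed.on (T * U)%type.

(** [P] is the law of [code] under the uniform distribution on [0, 1[: a cylinder pulls back to an
    interval whose length is the required product. *)
Lemma exists_iid {R : realType} {T : ptopologicalType} {S : countType}
    (X : T -> nat -> S) (l w : S -> R) (sym : R -> S) (f : R -> R) (code : R -> T) :
    cylinder_base X ->
    (forall s, 0 <= l s) -> (forall s, 0 <= w s) -> (forall s, l s + w s <= 1) ->
    (forall u s, 0 <= u < 1 -> (sym u == s) = (l s <= u < l s + w s)) ->
    (forall u, f u = (u - l (sym u)) / w (sym u)) ->
    (forall s, measurable (sym @^-1` [set s])) -> measurable_fun setT f ->
    (forall u i, X (code u) i = sym (iter i f u)) ->
  exists P : probability (Borel T) R,
    forall n a, P (cylinder X n a) = (\prod_(i < n) w (a i))%:E.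
Proof.
move=> bX l_ge0 w_ge0 lw_le1 symE fE msym mf codeE.
have mcode : measurable_fun setT (code : measurableTypeR R -> Borel T).
  apply: (measurable_fun_coordinates X) => // i s.
  rewrite (_ : [set u | _] = iter i f @^-1` (sym @^-1` [set s])); last first.
    by apply/seteqP; split=> u /=; rewrite codeE.
  rewrite -[X in measurable X]setTI.
  have mfi : measurable_fun setT (iter i f : measurableTypeR R -> measurableTypeR R).
    elim: i => [|i IHi] /=; first exact: measurable_id.
    exact: measurableT_comp.
  exact: (mfi measurableT _ (msym s)).
exists (distribution (unit_lebesgue R) (mfun_Sub (mem_set mcode))) => n a.
have [s [t [s_ge0 le_st t_le1 <- stE]]] :=
  coding_interval l w sym f l_ge0 w_ge0 lw_le1 symE fE n a.
have codeI : code @^-1` cylinder X n a `&` `[0 : R, 1[%classic = `[s, t[%classic.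
  apply/seteqP; split=> u /=; rewrite !in_itv/=.
    by move=> [ua u01]; apply/stE => // i ltin; rewrite -codeE ua.
  move=> ust; have u01 : 0 <= u < 1 by lra.
  by split=> // i ltin; rewrite codeE; move: i ltin; apply/stE.
transitivity (lebesgue_measure (`[s, t[%classic : set R)); first by rewrite -codeI.
rewrite lebesgue_measure_itv/= lte_fin.
(* When [s = t] the interval is empty and both sides are 0. *)
by move: le_st; rewrite le_eqVlt => /predU1P[->|->//]; rewrite ltxx subrr.
Qed.

(** * The monotone coupling *)

(** For [0 <= p <= q <= 1], the law of [(p <= U, q <= U)] with [U] uniform on [0, 1[; its mass off
    the diagonal is [q - p]. *)
Definition pair_weight {R : pzRingType} (p q : R) (s : bool * bool) : R :=
  if s.2 then (if s.1 then 1 - q else 0) else if s.1 then q - p else p.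

Lemma exists_monotone_coupling {R : realType} (p q : R) :
    0 <= p -> p <= q -> q <= 1 ->
  exists lam : probability (Borel Omega2) R, forall n a,
    lam (cylinder (fun (z : Omega2) i => (z.1 i, z.2 i)) n a) =
    (\prod_(i < n) pair_weight p q (a i))%:E.
Proof.
move=> p_ge0 le_pq q_le1.
(* The pair [(false, true)] has weight 0, so its left endpoint is irrelevant. *)
pose l (s : bool * bool) : R := if s.2 then q else if s.1 then p else 0.
pose sym (u : R) := (p <= u, q <= u).
pose f (u : R) := (u - l (sym u)) / pair_weight p q (sym u).
pose code (u : R) : Omega2 := (fun i => p <= iter i f u, fun i => q <= iter i f u).
have mp : measurable_fun setT (fun u : measurableTypeR R => p <= u).
  exact: measurable_fun_ler.
have mq : measurable_fun setT (fun u : measurableTypeR R => q <= u).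
  exact: measurable_fun_ler.
have := @exists_iid R Omega2 (bool * bool)%type _ l (pair_weight p q) sym f code.
apply => //.
- exact: cylinder_base_Omega2.
- by move=> [[] []]; rewrite /l/=; lra.
- by move=> [[] []]; rewrite /pair_weight/=; lra.
- by move=> [[] []]; rewrite /l /pair_weight/=; lra.
- move=> u [a b] u01; rewrite /sym /l /pair_weight xpair_eqE/=.
  by case: a; case: b; case: (leP p u) => pu; case: (leP q u) => qu /=;
    apply/idP/idP => // ?; lra.
- move=> [a b].
  rewrite (_ : _ @^-1` _ = (fun u : R => p <= u) @^-1` [set a] `&`
    (fun u : R => q <= u) @^-1` [set b]); last first.
    by apply/seteqP; split=> [u [<- <-]|u /= [<- <-]].
  by apply: measurableI; rewrite -[X in measurable X]setTI; [exact: mp|exact: mq].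
- rewrite /f /l /pair_weight /sym /=.
  apply: measurable_funM.
    apply: measurable_funB => //.
    by do ?apply: measurable_fun_ifT.
  (* Moving the inverse into the branches leaves tests between constants, so measurability follows
     from that of the two tests. *)
  have -> : (fun u => (if q <= u then if p <= u then 1 - q else 0
      else if p <= u then q - p else p)^-1) =
    (fun u => if q <= u then if p <= u then (1 - q)^-1 else 0^-1
      else if p <= u then (q - p)^-1 else p^-1).
    by apply/funext => u; do 2 case: ifP => _.
  by do ?apply: measurable_fun_ifT.
Qed.

Lemma measurable_coordinate {T : ptopologicalType} {S : Type} (X : T -> nat -> S)
    (i : nat) (Q : set S) :
  cylinder_base X -> measurable ([set x | Q (X x i)] : set (Borel T)).
Proof.
move=> [oX _]; apply: sub_sigma_algebra.
rewrite (_ : [set x | _] = \bigcup_(s in Q) [set x | X x i = s]).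
  by apply: bigcup_open => s _; exact: oX.
by apply/seteqP; split=> [x Qx|x [s Qs /= ->//]]; exists (X x i).
Qed.

Lemma sum_bool_pair {R : pzSemiRingType} (Q : pred (bool * bool))
    (F : bool * bool -> R) :
  \sum_(s | Q s) F s =
  (if Q (true, true) then F (true, true) else 0) +
  (if Q (true, false) then F (true, false) else 0) +
  ((if Q (false, true) then F (false, true) else 0) +
   (if Q (false, false) then F (false, false) else 0)).
Proof.
rewrite big_mkcond (eq_bigr (fun s => if Q (s.1, s.2) then F (s.1, s.2) else 0)).
  by rewrite -(pair_bigA _ (fun a b => if Q (a, b) then F (a, b) else 0))/= !big_bool.
by move=> [].
Qed.

Local Notation pair_coordinates := (fun (z : Omega2) i => (z.1 i, z.2 i)).

Lemma measurable_first_symbols_differ :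
  measurable (first_symbols_differ : set (Borel Omega2)).
Proof.
exact: (measurable_coordinate pair_coordinates 0%N [set s | s.1 <> s.2])
  cylinder_base_Omega2.
Qed.

(** Each condition equates two Borel probabilities, so cylinders suffice. Summing [pair_weight] over
    one symbol of the pair gives the Bernoulli weights of the other. *)
Lemma coupling_in_joinings {R : realType} (p1 p2 q1 q2 : R)
    (mu nu : probability (Borel Omega) R) (lam : probability (Borel Omega2) R) :
    p1 + p2 = 1 -> q1 + q2 = 1 ->
    is_bernoulli p1 p2 mu -> is_bernoulli q1 q2 nu ->
    (forall n a, lam (cylinder pair_coordinates n a) =
       (\prod_(i < n) pair_weight p1 q1 (a i))%:E) ->
  joinings mu nu lam.
Proof.
move=> p_sum1 q_sum1 mu_bernoulli nu_bernoulli lamE.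
have bX := cylinder_base_Omega2.
have lamQ := probability_coordinates pair_coordinates _ lam bX lamE.
have mfst : measurable_fun setT (fst : Borel Omega2 -> Borel Omega).
  apply: (measurable_fun_coordinates _ _ cylinder_base_Omega) => i s.
  exact: (measurable_coordinate pair_coordinates i [set c | c.1 = s] bX).
have msnd : measurable_fun setT (snd : Borel Omega2 -> Borel Omega).
  apply: (measurable_fun_coordinates _ _ cylinder_base_Omega) => i s.
  exact: (measurable_coordinate pair_coordinates i [set c | c.2 = s] bX).
have mshift : measurable_fun setT (shift2 : Borel Omega2 -> Borel Omega2).
  apply: (measurable_fun_coordinates _ _ bX) => i s.
  exact: (measurable_coordinate pair_coordinates i.+1 [set s] bX).
split.
- move=> A mA.
  apply: (eq_probability_cylinder _ (distribution lam (mfun_Sub (mem_set mfst))) mu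
    cylinder_base_Omega _ _ mA) => n a.
  rewrite [RHS]mu_bernoulli.
  transitivity (lam [set z | forall i, (i < n)%N -> z.1 i == a i]).
    by congr (lam _); apply/seteqP; split=> z za i /za /eqP.
  rewrite (lamQ n (fun i s => s.1 == a i)); congr (_%:E).
  apply: eq_bigr => i _; rewrite sum_bool_pair /pair_weight /symbol_weight/=.
  by case: (a i) => /=; lra.
- move=> A mA.
  apply: (eq_probability_cylinder _ (distribution lam (mfun_Sub (mem_set msnd))) nu
    cylinder_base_Omega _ _ mA) => n a.
  rewrite [RHS]nu_bernoulli.
  transitivity (lam [set z | forall i, (i < n)%N -> z.2 i == a i]).
    by congr (lam _); apply/seteqP; split=> z za i /za /eqP.
  rewrite (lamQ n (fun i s => s.2 == a i)); congr (_%:E).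
  apply: eq_bigr => i _; rewrite sum_bool_pair /pair_weight /symbol_weight/=.
  by case: (a i) => /=; lra.
- move=> C mC.
  apply: (eq_probability_cylinder _ (distribution lam (mfun_Sub (mem_set mshift))) lam
    bX _ _ mC) => n a.
  rewrite [RHS]lamE.
  (* The preimage of a cylinder under [shift2] leaves index 0 free and constrains index [j.+1] by
     [a j]; the free factor sums to 1. *)
  pose Q i (s : bool * bool) := if i is j.+1 then s == a j else true.
  transitivity (lam [set z | forall i, (i < n.+1)%N -> Q i (z.1 i, z.2 i)]).
    congr (lam _); apply/seteqP; split=> z za.
      by move=> [//|i] ltin; apply/eqP; exact: (za i ltin).
    by move=> i ltin; apply/eqP; exact: (za i.+1 ltin).
  rewrite (lamQ n.+1 Q) big_ord_recl/= sum_bool_pair/= /pair_weight/=.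
  rewrite (_ : _ + _ = 1); last lra.
  by rewrite mul1r; congr (_%:E); apply: eq_bigr => i _; rewrite big_pred1_eq.
Qed.

(** * Lower bound and value of the distance *)

Lemma joining_ge_diff {R : realType} (p1 p2 q1 q2 : R)
    (mu nu : probability (Borel Omega) R) (lam : probability (Borel Omega2) R) :
    is_bernoulli p1 p2 mu -> is_bernoulli q1 q2 nu -> joinings mu nu lam ->
  ((q1 - p1)%:E <= lam first_symbols_differ)%E.
Proof.
move=> mu_bernoulli nu_bernoulli [lam_fst lam_snd _].
pose A : set Omega := [set x | x 0%N = false].
have mA : measurable (A : set (Borel Omega)).
  exact: (measurable_coordinate _ 0%N [set false] cylinder_base_Omega).
have cylA : A = [set x : Omega | forall i, (i < 1)%N -> x i = (fun=> false) i].
  by apply/seteqP; split=> x xA => [[]|]//; exact: xA.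
have muA : mu A = p1%:E by rewrite cylA mu_bernoulli big_ord_recl big_ord0 mulr1.
have nuA : nu A = q1%:E by rewrite cylA nu_bernoulli big_ord_recl big_ord0 mulr1.
have mcoord := measurable_coordinate pair_coordinates 0%N _ cylinder_base_Omega2.
have m1 : measurable (fst @^-1` A : set (Borel Omega2)).
  exact: (mcoord [set s | s.1 = false]).
have m2 : measurable (snd @^-1` A : set (Borel Omega2)).
  exact: (mcoord [set s | s.2 = false]).
have mD := measurable_first_symbols_differ.
rewrite EFinB leeBlDr// -muA -nuA -lam_fst// -lam_snd//.
(* The set where [z.2] starts with [false] lies in this union; subadditivity then concludes. *)
apply: (@le_trans _ _ (lam (first_symbols_differ `|` fst @^-1` A))).
  apply: le_measure; rewrite ?inE//; first exact: measurableU.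
  move=> z /= zA; rewrite /first_symbols_differ/= /A/=.
  by have [->|] := pselect (z.1 0%N = z.2 0%N); [right|left].
exact: measureU2.
Qed.

Theorem theorem4 (R : realType) (p1 p2 q1 q2 : R)
    (p1_ge0 : 0 <= p1) (p2_ge0 : 0 <= p2) (p_sum1 : p1 + p2 = 1)
    (q1_ge0 : 0 <= q1) (q2_ge0 : 0 <= q2) (q_sum1 : q1 + q2 = 1)
    (mu nu : probability (Borel Omega) R)
    (mu_bernoulli : is_bernoulli p1 p2 mu)
    (nu_bernoulli : is_bernoulli q1 q2 nu)
    (le_p1_q1 : p1 <= q1) :
  dbar mu nu = (q1 - p1)%:E /\
  q1 - p1 = 2^-1 * (`|q1 - p1| + `|q2 - p2|).
Proof.
split; last by rewrite ger0_norm ?ler0_norm; lra.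
have costE (lam : probability (Borel Omega2) R) :
    (\int[lam]_z (\1_first_symbols_differ z : R)%:E)%E = lam first_symbols_differ.
  by rewrite integral_indic ?setIT//; exact: measurable_first_symbols_differ.
apply/eqP; rewrite eq_le; apply/andP; split; last first.
  apply: le_ereal_inf_tmp => _ [lam lamJ <-]; rewrite costE.
  exact: joining_ge_diff mu_bernoulli nu_bernoulli lamJ.
(* The infimum is at most the cost of the monotone coupling, which equals the lower bound. *)
have [|lam lamE] := exists_monotone_coupling p1 q1 p1_ge0 le_p1_q1; first lra.
apply: ge_ereal_inf; exists (lam first_symbols_differ).
  exists lam; last exact: costE.
  exact: (coupling_in_joinings p1 p2 q1 q2).
suff -> : lam first_symbols_differ = (q1 - p1)%:E by [].
(* As an event on one coordinate, it has probability the sum of the weights of [(true, false)] and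
   [(false, true)], namely [q1 - p1] and 0. *)
transitivity (lam [set z | forall i, (i < 1)%N -> z.1 i != z.2 i]).
  congr (lam _); apply/seteqP; split=> z.
    by move=> /eqP zD [].
  by move=> zD; apply/eqP; exact: zD.
rewrite (probability_coordinates pair_coordinates _ lam cylinder_base_Omega2 lamE 1
  (fun _ s => s.1 != s.2)) big_ord_recl big_ord0 sum_bool_pair/= /pair_weight/=.
by congr (_%:E); lra.
Qed.
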